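(* Let $H$ be a bipartite graph with $n$ vertices and maximum degree $\Delta \geq 1$. If $\epsilon>0$ and $G$ is a graph with $N \geq 32\Delta \epsilon^{-\Delta}n$ vertices and at least $\epsilon\binom{N}{2}$ edges, then $H$ is a subgraph of $G$.
   Context: All graphs are finite and simple. ''$H$ is a subgraph of $G$'' means there is an injective map from the vertex set of $H$ to the vertex set of $G$ sending edges of $H$ to edges of $G$.
   Formalization: The formal theorem additionally assumes N > 1; without it the claim fails for N = 1 with large ε (e.g. H = K_2, Δ = 1, n = 2, ε = 64), and for ε ≤ 1 the condition is automatic. *)

(* Defs.v *)
From mathcomp Require Import all_boot all_order all_algebra.
From mathcomp Require Import reals.

Set Implicit Arguments.
Unset Strict Implicit.
Unset Printing Implicit Defensive.

Record sgraph := SGraph {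
  vertex :> finType;
  adj : rel vertex;
  adj_sym : symmetric adj;
  adj_irrefl : irreflexive adj }.

Definition edges (G : sgraph) : {set {set G}} :=
  [set e | [exists x, exists y, adj x y && (e == [set x; y])]].

Definition degree (G : sgraph) (x : G) : nat := #|[set y | adj x y]|.

Definition max_degree (G : sgraph) : nat := \max_(x : G) degree x.

Definition bipartite (G : sgraph) : Prop :=
  exists A : {set G}, forall x y : G, adj x y -> (x \in A) != (y \in A).

Definition is_subgraph (H G : sgraph) : Prop :=
  exists f : H -> G,
    injective f /\ (forall x y : H, adj x y -> adj (f x) (f y)).

(* Main.v *)
(** Dependent random choice followed by a greedy embedding.  Write [d] for the
    maximum degree.  For [d] random vertices [T] of [G] (with repetition), the
    common neighbourhood [U] of [T] has a large [d]-th moment by convexity, while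
    a [d]-tuple with fewer than [n] common neighbours lies in [U] with
    probability less than [(n / N) ^ d].  Hence some [U] has at least [8 d n]
    vertices and fewer than [(#|U| / (8 d)) ^ d] bad [d]-tuples.  One side of [H]
    is embedded in [U] vertex by vertex, keeping the already embedded part [S] of
    every neighbourhood such that fewer than [(#|U| / (8 d)) ^ (d - #|S|)] of its
    completions are bad: each of the at most [d] neighbourhoods concerned forbids
    fewer than [#|U| / (8 d)] choices.  At the end every neighbourhood has [n]
    common neighbours in [G], so the other side is embedded greedily. *)

Require Import Defs.
From mathcomp Require Import all_boot all_order all_algebra.
From mathcomp Require Import reals.
From mathcomp Require Import zify ring lra.

Import Order.TTheory GRing.Theory Num.Theory.
Local Open Scope ring_scope.

Set Implicit Arguments.
Unset Strict Implicit.
Unset Printing Implicit Defensive.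

(** * Convexity of powers *)

Lemma tangent_le_expr (R : realFieldType) (x a : R) (d : nat) :
  0 <= x -> 0 <= a -> a ^+ d.+1 + d.+1%:R * a ^+ d * (x - a) <= x ^+ d.+1.
Proof.
move=> x0 a0; elim: d => [|d IHd]; first by rewrite !expr1 expr0; lra.
rewrite [leRHS]exprS; apply: (le_trans _ (ler_wpM2l x0 IHd)); rewrite -subr_ge0.
suff -> : x * (a ^+ d.+1 + d.+1%:R * a ^+ d * (x - a))
    - (a ^+ d.+2 + d.+2%:R * a ^+ d.+1 * (x - a))
    = d.+1%:R * a ^+ d * (x - a) ^+ 2.
  by rewrite mulr_ge0 ?sqr_ge0 // mulr_ge0 ?exprn_ge0.
rewrite !exprS -(natr1 d.+1); ring.
Qed.

(** Sum the tangent inequality at [a]: the linear terms add up to a nonnegative quantity. *)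
Lemma power_mean_le (R : realFieldType) (I : finType) (x : I -> R) (a : R)
    (d : nat) :
  (forall i, 0 <= x i) -> 0 <= a -> #|I|%:R * a <= \sum_i x i ->
  #|I|%:R * a ^+ d.+1 <= \sum_i x i ^+ d.+1.
Proof.
move=> x0 a0 le_sum.
have : \sum_i (a ^+ d.+1 + d.+1%:R * a ^+ d * (x i - a)) <= \sum_i x i ^+ d.+1.
  by apply: ler_sum => i _; apply: tangent_le_expr.
apply: le_trans.
rewrite mulr_natl in le_sum.
rewrite big_split /= -mulr_sumr sumrB !sumr_const mulr_natl lerDl.
by rewrite mulr_ge0 ?subr_ge0 // mulr_ge0 ?exprn_ge0.
Qed.

Local Open Scope nat_scope.

(** * Common neighbourhoods and bad tuples *)

Section CommonNeighbours.
Variable G : sgraph.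

Definition common_nbrs (S : {set G}) : {set G} :=
  [set v | [forall u in S, adj u v]].

Lemma common_nbrsP (S : {set G}) (v : G) :
  reflect (forall u, u \in S -> adj u v) (v \in common_nbrs S).
Proof. by rewrite inE; apply: forall_inP. Qed.

Lemma common_nbrsS (S S' : {set G}) :
  S \subset S' -> common_nbrs S' \subset common_nbrs S.
Proof.
move=> SS'; apply/subsetP => v /common_nbrsP vS'; apply/common_nbrsP => u uS.
by apply: vS'; apply: (subsetP SS').
Qed.

(** Double counting of incidences: an edge through [x] is [[set x; y]] for some neighbour [y] of
    [x]. *)
Lemma double_edges_le : 2 * #|edges G| <= \sum_(x : G) degree x.
Proof.
have -> : 2 * #|edges G| = \sum_(e in edges G) \sum_(x : G | x \in e) 1.
  rewrite mulnC -sum_nat_const; apply: eq_bigr => e.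
  rewrite inE => /existsP[x /existsP[y /andP[xy /eqP->]]].
  rewrite sum1_card cards2; case: eqP => // exy.
  by move: xy; rewrite exy adj_irrefl.
rewrite (exchange_big_dep predT) //=; apply: leq_sum => x _.
rewrite sum1dep_card /degree.
apply: leq_trans (leq_imset_card (fun y => [set x; y]) _).
apply/subset_leq_card/subsetP => e; rewrite 2!inE => /andP[].
move=> /existsP[y /existsP[z /andP[yz /eqP->]]] /set2P[->|->].
  by apply/imsetP; exists z; rewrite ?inE.
by apply/imsetP; exists y; rewrite ?inE 1?adj_sym // setUC.
Qed.

Lemma degree_le (x : G) : degree x <= #|G|.-1.
Proof.
rewrite /degree -(cardsC1 x); apply/subset_leq_card/subsetP => y.
by rewrite !inE => xy; apply: contraTneq xy => ->; rewrite adj_irrefl.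
Qed.

Variable n : nat.

(* The number of [k]-tuples [s] in [U] such that [S], together with the entries
   of [s], has fewer than [n] common neighbours. *)
Fixpoint bad_ext (U : {set G}) (k : nat) (S : {set G}) : nat :=
  if k is k'.+1 then \sum_(x in U) bad_ext U k' (x |: S)
  else #|common_nbrs S| < n.

Lemma bad_ext_full (U S : {set G}) (k : nat) :
  #|common_nbrs S| < n -> bad_ext U k S = #|U| ^ k.
Proof.
elim: k S => [|k IHk] S badS /=; first by rewrite badS.
rewrite (eq_bigr (fun=> #|U| ^ k)) ?sum_nat_const -?expnS // => x _.
apply: IHk; apply: leq_ltn_trans badS.
exact/subset_leq_card/common_nbrsS/subsetUr.
Qed.

(** Denominator-free form of: the proportion of bad [k]-tuples in [U] is below [c ^ -k]. For [k = 0]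
    it says that [S] itself is not bad. *)
Definition few_bad_ext (U : {set G}) (c k : nat) (S : {set G}) : bool :=
  bad_ext U k S * c ^ k < #|U| ^ k.

Lemma few_bad_ext_card (U S : {set G}) (c k : nat) :
  0 < c -> few_bad_ext U c k S -> n <= #|common_nbrs S|.
Proof.
move=> c0; rewrite leqNgt; apply: contraTN => /(bad_ext_full U k).
by rewrite /few_bad_ext => ->; rewrite -leqNgt leq_pmulr // expn_gt0 c0.
Qed.

(** Markov's inequality: each [x] in the set accounts for at least [(#|U| / c) ^ k] of the bad
    [k.+1]-tuples. *)
Lemma card_few_bad_extN (U S : {set G}) (c k : nat) :
  0 < #|U| -> few_bad_ext U c k.+1 S ->
  #|[set x in U | ~~ few_bad_ext U c k (x |: S)]| * c < #|U|.
Proof.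
move=> U0; rewrite /few_bad_ext /= => few.
set B := [set x in U | _].
rewrite -(@ltn_pmul2r (#|U| ^ k)) ?expn_gt0 ?U0 // -expnS.
apply: leq_ltn_trans few.
rewrite expnS mulnAC (mulnC c) mulnA leq_mul2r; apply/orP; right.
rewrite big_distrl /= -sum_nat_const [leqRHS](bigID (mem B)) /=.
apply: leq_trans (leq_addr _ _).
rewrite [leqRHS](eq_bigl (mem B)) => [|x]; last first.
  by rewrite !inE; case: (x \in U).
by apply: leq_sum => x; rewrite inE -leqNgt => /andP[].
Qed.

(** * Averages over random samples *)

Section Sampling.
Variable d : nat.
Implicit Type T : {ffun 'I_d -> G}.

Definition sample_nbrs T : {set G} := common_nbrs [set T i | i : 'I_d].

Lemma sample_nbrsE T (x : G) :
  (x \in sample_nbrs T) = [forall i, adj x (T i)].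
Proof.
apply/common_nbrsP/forallP => [xT i|xT u /imsetP[i _ ->]].
  by rewrite adj_sym; apply/xT/imset_f.
by rewrite adj_sym.
Qed.

Lemma ffun_on_common_nbrs T (x : G) (S : {set G}) :
  (T \in ffun_on (mem (common_nbrs (x |: S)))) =
  (T \in ffun_on (mem (common_nbrs S))) && (x \in sample_nbrs T).
Proof.
rewrite sample_nbrsE.
apply/ffun_onP/andP => [TxS|[/ffun_onP TS /forallP xT] i].
  split; last by apply/forallP => i; apply: (common_nbrsP _ _ (TxS i)); rewrite setU11.
  by apply/ffun_onP => i; apply: (subsetP (common_nbrsS (subsetUr _ _)) _ (TxS i)).
by apply/common_nbrsP => u /setU1P[->|]; [apply: xT|apply/common_nbrsP/TS].
Qed.

(* The restriction to samples [T] lying in [common_nbrs S], that is, with [S]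
   inside [sample_nbrs T], makes the induction on [k] go through. *)
Lemma sum_bad_ext_on (k : nat) (S : {set G}) :
  \sum_(T | T \in ffun_on (mem (common_nbrs S))) bad_ext (sample_nbrs T) k S
    <= #|G| ^ k * n ^ d.
Proof.
elim: k S => [|k IHk] S /=.
  rewrite sum_nat_const card_ffun_on card_ord mul1n.
  case: ltnP => [/ltnW le_n|_]; rewrite ?muln0 // muln1.
  by have [->|d0] := posnP d; rewrite ?expn0 // leq_exp2r.
(* Once [x] is summed first, the samples left are those in [common_nbrs (x |: S)], so induction
   applies for each [x]. *)
rewrite (exchange_big_dep predT) //= expnS -mulnA -sum_nat_const.
apply: leq_sum => x _; apply: leq_trans (IHk (x |: S)).
by rewrite (eq_bigl _ _ (fun T => ffun_on_common_nbrs T x S)).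
Qed.

Lemma sum_bad_ext (k : nat) :
  \sum_T bad_ext (sample_nbrs T) k set0 <= #|G| ^ k * n ^ d.
Proof.
apply: leq_trans (sum_bad_ext_on k set0); rewrite leq_eqVlt; apply/orP; left.
apply/eqP/eq_bigl => T; apply/esym/ffun_onP => i.
by apply/common_nbrsP => u; rewrite inE.
Qed.

(** Count pairs [(T, x)] with [x] adjacent to every entry of [T]: given [x], each entry is any
    neighbour of [x]. *)
Lemma sum_sample_nbrs : \sum_T #|sample_nbrs T| = \sum_(x : G) degree x ^ d.
Proof.
under eq_bigr do rewrite -sum1_card.
rewrite (exchange_big_dep predT) //=; apply: eq_bigr => x _.
rewrite sum1dep_card /degree -[in RHS](card_ord d) -card_ffun_on.
apply: eq_card => T; rewrite inE sample_nbrsE.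
by apply/forallP/ffun_onP => xT i; have := xT i; rewrite inE.
Qed.

End Sampling.
End CommonNeighbours.

(** With [N = #|G|], the power mean gives at least [N * (eps * (N - 1)) ^ d]. Here [eps ^ d * N] is
    at least [32 * d * n], and replacing [(N - 1) ^ d] by [N ^ d] costs a factor of at most 2. *)
Lemma sum_degree_expr_ge (R : realFieldType) (G : sgraph) (d n : nat) (eps : R) :
  (0 < eps)%R -> 0 < d -> 0 < n -> 1 < #|G| ->
  (32%:R * d%:R * eps ^- d * n%:R <= #|G|%:R)%R ->
  (eps * 'C(#|G|, 2)%:R <= #|edges G|%:R)%R ->
  #|G| ^ d * (16 * d * n) <= \sum_(x : G) degree x ^ d.
Proof.
move=> eps0 d0 n0 N1 N_ge e_ge.
have bin2N : (2 * 'C(#|G|, 2) = #|G| * #|G|.-1).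
  by rewrite -mul_bin_diag bin1.
have deg_ge : (#|G|%:R * (eps * #|G|.-1%:R) <= \sum_(x : G) (degree x)%:R :> R)%R.
  rewrite mulrCA -natrM -bin2N natrM mulrCA -natr_sum.
  apply: (@le_trans _ _ (2 * #|edges G|)%:R%R); last by rewrite ler_nat double_edges_le.
  by rewrite natrM ler_wpM2l.
have eps1 : (eps <= 1)%R.
  have : (eps * (#|G| * #|G|.-1)%:R <= (#|G| * #|G|.-1)%:R :> R)%R.
    rewrite {1}natrM mulrCA; apply: le_trans deg_ge _.
    rewrite -natr_sum ler_nat -sum_nat_const; apply: leq_sum => x _.
    exact: degree_le.
  by rewrite ger_pMl // ltr0n muln_gt0; lia.
have epsd0 : (0 < eps ^+ d)%R by rewrite exprn_gt0.
have epsd_ge : (32%:R * d%:R * n%:R <= eps ^+ d * #|G|%:R :> R)%R.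
  have := ler_wpM2l (ltW epsd0) N_ge; congr (_ <= _)%R.
  by field; rewrite gt_eqF.
have d2_le : 2 * d <= #|G|.
  have : (32%:R * d%:R * n%:R <= #|G|%:R :> R)%R.
    by apply: le_trans epsd_ge _; rewrite ler_piMl // exprn_ile1 // ltW.
  by rewrite -!natrM ler_nat; have := leq_mul (leqnn (32 * d)) n0; lia.
(* Bernoulli's inequality, from the tangent at [#|G|] evaluated at [#|G| - 1]; [d2_le] bounds the
   loss by half. *)
have half : (#|G|%:R ^+ d <= 2 * #|G|.-1%:R ^+ d :> R)%R.
  case: d d0 d2_le {N_ge epsd0 epsd_ge} => // d _ d2_le.
  have := @tangent_le_expr R #|G|.-1%:R #|G|%:R d (ler0n _ _) (ler0n _ _).
  have -> : (#|G|.-1%:R - #|G|%:R = -1 :> R)%R.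
    by rewrite -{2}(@prednK #|G|) ?(ltnW N1) // -natr1; ring.
  have : (2 * d.+1%:R * #|G|%:R ^+ d <= #|G|%:R ^+ d.+1 :> R)%R.
    by rewrite exprS ler_wpM2r ?exprn_ge0 // -natrM ler_nat.
  by move=> ? ?; lra.
rewrite -(ler_nat R) natr_sum; under eq_bigr do rewrite natrX.
have := @power_mean_le R G (fun x => (degree x)%:R%R) (eps * #|G|.-1%:R) d.-1.
rewrite prednK // => /(_ (fun=> ler0n _ _)).
move=> /(_ (mulr_ge0 (ltW eps0) (ler0n _ _)) deg_ge).
apply: le_trans; rewrite exprMn mulrA natrM natrX !natrM.
have := ler_wpM2r (exprn_ge0 d (ler0n R #|G|.-1)) epsd_ge.
rewrite (mulrC (eps ^+ d)%R); apply: le_trans.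
have c0 : (0 <= 16%:R * d%:R * n%:R :> R)%R by rewrite -!natrM.
have := ler_wpM2l c0 half.
by rewrite mulrC => /le_trans; apply; rewrite le_eqVlt; apply/orP; left; apply/eqP; ring.
Qed.

Lemma dependent_random_choice (R : realFieldType) (G : sgraph) (d n : nat)
    (eps : R) :
  (0 < eps)%R -> 0 < d -> 0 < n -> 1 < #|G| ->
  (32%:R * d%:R * eps ^- d * n%:R <= #|G|%:R)%R ->
  (eps * 'C(#|G|, 2)%:R <= #|edges G|%:R)%R ->
  exists U : {set G}, 8 * d * n <= #|U| /\ few_bad_ext n U (8 * d) d set0.
Proof.
move=> eps0 d0 n0 N1 N_ge e_ge.
have deg_ge := sum_degree_expr_ge eps0 d0 n0 N1 N_ge e_ge.
pose U (T : {ffun 'I_d -> G}) := sample_nbrs T.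
have card_T : #|{ffun 'I_d -> G}| = #|G| ^ d by rewrite card_ffun card_ord.
have moment : #|G| ^ d * (16 * d * n) ^ d <= \sum_T #|U T| ^ d.
  rewrite -(ler_nat rat) natrM natr_sum -card_T; under eq_bigr do rewrite natrX.
  have := @power_mean_le rat _ (fun T => #|U T|%:R%R) (16 * d * n)%:R%R d.-1.
  rewrite prednK // => /(_ (fun=> ler0n _ _) (ler0n _ _)).
  rewrite natrX; apply; rewrite -natrM -natr_sum ler_nat card_T.
  by rewrite sum_sample_nbrs.
(* One inequality yields both conclusions: dropping the first term bounds the size of [U T], and
   positivity of the second makes the bound on bad tuples strict. *)
have [T lt_T|no_T] := pickP (fun T => bad_ext n (U T) d set0 * (8 * d) ^ d
    + (8 * d * n) ^ d <= #|U T| ^ d).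
  exists (U T); split.
    by rewrite -(@leq_exp2r _ _ d) //; apply: leq_trans lt_T; apply: leq_addl.
  apply: leq_trans lt_T; rewrite -addn1 leq_add2l expn_gt0.
  by rewrite !muln_gt0 d0 n0.
have : \sum_T #|U T| ^ d < \sum_T (bad_ext n (U T) d set0 * (8 * d) ^ d
    + (8 * d * n) ^ d).
  apply: (@leq_trans (\sum_T (1 + #|U T| ^ d))); last first.
    by apply: leq_sum => T _; rewrite add1n ltnNge no_T.
  by rewrite big_split sum1_card card_T /= -[leqLHS]add1n leq_add2r expn_gt0 ltnW.
rewrite ltnNge => /negP[]; apply: leq_trans moment.
rewrite big_split /= sum_nat_const card_T -big_distrl /=.
(* Each of the two terms averages at most [(8 * d * n) ^ d], and [2 <= 2 ^ d] because [d] is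
   positive. *)
have -> : 16 * d * n = 2 * (8 * d * n) by lia.
rewrite (expnMn 2) [leqRHS]mulnCA.
apply: (@leq_trans (2 * (#|G| ^ d * (8 * d * n) ^ d))).
  rewrite mul2n -addnn leq_add2r.
  apply: leq_trans (leq_mul (sum_bad_ext G n d d) (leqnn _)) _.
  by rewrite -mulnA -expnMn (mulnC n).
by rewrite leq_mul2r -[leqLHS](expn1 2) leq_pexp2l ?orbT.
Qed.

(** * Greedy embedding of the two sides *)

Section Embedding.
Variables (H G : sgraph) (n d : nat).

Definition nbrs (b : H) : {set H} := [set y | adj b y].

Definition update (f : H -> G) (a : H) (v : G) (z : H) : G :=
  if z == a then v else f z.

Lemma update_imset (f : H -> G) (a : H) (v : G) (D : {set H}) :
  a \notin D -> [set update f a v z | z in D] = [set f z | z in D].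
Proof.
move=> aD; apply: eq_in_imset => z zD; rewrite /update.
by case: eqP => // za; rewrite za (negPf aD) in zD.
Qed.

Lemma update_imset1 (f : H -> G) (a : H) (v : G) (D : {set H}) :
  a \notin D -> [set update f a v z | z in a |: D] = v |: [set f z | z in D].
Proof.
by move=> aD; rewrite imsetU1 update_imset // /update eqxx.
Qed.

Lemma update_inj (f : H -> G) (a : H) (v : G) (D : {set H}) :
  a \notin D -> v \notin [set f z | z in D] -> {in D &, injective f} ->
  {in a |: D &, injective (update f a v)}.
Proof.
move=> aD vfD injf x y /setU1P xD /setU1P yD; rewrite /update.
have fD z : z \in D -> v <> f z by move=> zD vz; rewrite vz imset_f in vfD.
case: eqP xD => [-> _|_ []// xD]; case: eqP yD => [-> _|_ []// yD] //.
- by move=> /(fD _ yD).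
- by move/esym=> /(fD _ xD).
- exact: injf.
Qed.

(** Greedy induction, one vertex at a time; it starts from [set0] for the side [A] and from [A] for
    the other side. *)
Lemma set_extension_ind (T : finType) (P : {set T} -> Prop) (D0 E : {set T}) :
  D0 \subset E -> P D0 ->
  (forall (D : {set T}) a, D0 \subset D -> D \subset E -> a \in E -> a \notin D ->
    P D -> P (a |: D)) ->
  P E.
Proof.
move=> D0E PD0 PU1.
suff ext (D : {set T}) : D0 \subset D -> D \subset E -> P D -> P E by exact: (ext D0).
have [m] := ubnP (#|E| - #|D|).
elim: m D => // m IHm D; rewrite ltnS => le_m D0D DE PD.
have [ED|/subsetPn[a aE aD]] := boolP (E \subset D).
  by have -> : E = D by apply/eqP; rewrite eqEsubset ED.
have aDE : a |: D \subset E by rewrite subUset sub1set aE.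
apply: (IHm (a |: D)) => //; last 1 first.
- exact: PU1.
- have := subset_leq_card aDE; rewrite cardsU1 aD; lia.
- exact: subset_trans D0D (subsetUr _ _).
Qed.

Lemma exists_avoiding (T : finType) (U B : {set T}) :
  #|B| < #|U| -> exists2 v, v \in U & v \notin B.
Proof.
move=> ltBU; apply/subsetPn; apply: contraL ltBU => UB.
by rewrite -leqNgt subset_leq_card.
Qed.

Hypothesis H_card : #|H| = n.
Hypothesis H_deg : forall x : H, #|nbrs x| <= d.
Variable A : {set H}.
Hypothesis A_bip : forall x y : H, adj x y -> (x \in A) != (y \in A).

Lemma greedy_embed_side (U : {set G}) :
  0 < d -> 0 < n -> 8 * d * n <= #|U| -> few_bad_ext n U (8 * d) d set0 ->
  exists f : H -> G, {in A &, injective f} /\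
    forall b, b \notin A -> n <= #|common_nbrs [set f z | z in nbrs b]|.
Proof.
move=> d0 n0 le_U few0.
have U0 : 0 < #|U| by apply: leq_trans le_U; rewrite !muln_gt0 d0.
have [v0 _] : exists v, v \in U by apply/set0Pn; rewrite -card_gt0.
pose P (D : {set H}) := exists f : H -> G, {in D &, injective f} /\
  forall b, b \notin A ->
    few_bad_ext n U (8 * d) (d - #|nbrs b :&: D|) [set f z | z in nbrs b :&: D].
suff [f [injf few]] : P A.
  exists f; split=> // b bA; have := few b bA.
  have -> : nbrs b :&: A = nbrs b.
    apply/setIidPl/subsetP => y; rewrite inE => /A_bip.
    by rewrite (negPf bA); case: (y \in A).
  by apply: few_bad_ext_card; rewrite muln_gt0.
apply: (@set_extension_ind _ P set0); rewrite ?sub0set //.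
  exists (fun=> v0); split=> [x y|b _]; first by rewrite inE.
  by rewrite setI0 imset0 cards0 subn0.
move=> D a _ DA aA aD [f [injf few]].
pose S b := [set f z | z in nbrs b :&: D].
pose Bad b := [set x in U |
  ~~ few_bad_ext n U (8 * d) (d - #|nbrs b :&: (a |: D)|) (x |: S b)].
(* Embedding [a] uses one free slot of each neighbour [b]; the degree bound keeps the truncated
   subtraction exact. *)
have card_nbrsD b : b \in nbrs a ->
    d - #|nbrs b :&: D| = (d - #|nbrs b :&: (a |: D)|).+1.
  rewrite inE => ab.
  have le_d : #|nbrs b :&: (a |: D)| <= d.
    by apply: leq_trans (H_deg b); apply/subset_leq_card/subsetIl.
  have -> : nbrs b :&: D = (nbrs b :&: (a |: D)) :\ a.
    by apply/setP=> z; rewrite !inE; case: eqP => //= ->; rewrite (negPf aD) andbF.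
  have := cardsD1 a (nbrs b :&: (a |: D)).
  rewrite !inE eqxx adj_sym ab /=; lia.
have card_Bad b : b \in nbrs a -> #|Bad b| * (8 * d) <= #|U|.
  move=> ab; apply/ltnW/card_few_bad_extN => //.
  rewrite -card_nbrsD //; apply: few; move: ab; rewrite inE => /A_bip.
  by rewrite aA; case: (b \in A).
(* Used vertices number at most [n], hence at most [#|U| / 8]; the at most [d] sets [Bad b] cover at
   most another [#|U| / 8]. *)
have [v vU vbad] : exists2 v, v \in U
    & v \notin [set f z | z in D] :|: \bigcup_(b in nbrs a) Bad b.
  apply: exists_avoiding; apply: leq_ltn_trans (leq_card_setU _ _) _.
  have le_fD : #|[set f z | z in D]| <= n.
    by rewrite -H_card (leq_trans (leq_imset_card _ _)) ?max_card.
  have le_bad : #|\bigcup_(b in nbrs a) Bad b| * (8 * d) <= d * #|U|.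
    apply: leq_trans (leq_mul (H_deg a) (leqnn _)).
    rewrite -[leqRHS]sum_nat_const.
    apply: (@leq_trans ((\sum_(b in nbrs a) #|Bad b|) * (8 * d))).
      apply: leq_mul => //.
      elim/big_ind2: _ => [|B s B' s' le_B le_B'|b _]; rewrite ?cards0 //.
      by apply: leq_trans (leq_card_setU _ _) _; apply: leq_add.
    by rewrite big_distrl /=; apply: leq_sum.
  have le_bad8 : #|\bigcup_(b in nbrs a) Bad b| * 8 <= #|U|.
    by rewrite -(leq_pmul2l d0); apply: leq_trans le_bad; lia.
  have n8 : 8 * n <= #|U|.
    by apply: leq_trans le_U; rewrite leq_mul2r leq_pmulr ?orbT.
  lia.
move: vbad; rewrite inE negb_or => /andP[vfD /bigcupP v_ok].
exists (update f a v); split; first exact: update_inj.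
move=> b bA; have [ab|ab] := boolP (b \in nbrs a).
  have nbrsU1 : nbrs b :&: (a |: D) = a |: (nbrs b :&: D).
    apply/setP=> z; move: ab; rewrite !inE => ab.
    by case: eqP => // ->; rewrite adj_sym ab.
  have abD : a \notin nbrs b :&: D by rewrite inE (negPf aD) andbF.
  have : v \notin Bad b by apply/negP => vb; apply: v_ok; exists b.
  by rewrite inE vU /= negbK nbrsU1 update_imset1.
have -> : nbrs b :&: (a |: D) = nbrs b :&: D.
  apply/setP=> z; move: ab; rewrite !inE => ab.
  by case: eqP => //= ->; rewrite adj_sym (negPf ab).
by rewrite update_imset ?few // inE (negPf aD) andbF.
Qed.

Lemma greedy_embed_rest (f : H -> G) :
  {in A &, injective f} ->
  (forall b, b \notin A -> n <= #|common_nbrs [set f z | z in nbrs b]|) ->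
  is_subgraph H G.
Proof.
move=> injf le_n.
(* For [b] outside [A], all neighbours lie in [A], where [f] is final, so [C b] never changes. It
   has at least [n] elements, while fewer than [n] are taken as long as [b] is not embedded. *)
pose C b := common_nbrs [set f z | z in nbrs b].
pose P (D : {set H}) := exists g : H -> G, [/\ {in D &, injective g},
  {in A, g =1 f} & forall b, b \in D -> b \notin A -> g b \in C b].
suff [g [injg gf gC]] : P setT.
  have adj_g x y : x \in A -> adj x y -> adj (g x) (g y).
    move=> xA xy; rewrite gf //.
    have yA : y \notin A by have := A_bip xy; rewrite xA; case: (y \in A).
    have /common_nbrsP := gC y (in_setT y) yA; apply.
    by apply: imset_f; rewrite inE adj_sym.
  exists g; split=> [x y|x y xy]; first by apply: injg; rewrite inE.
  have [xA|xA] := boolP (x \in A); first exact: adj_g.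
  rewrite adj_sym adj_g 1?adj_sym //; have := A_bip xy.
  by rewrite (negPf xA); case: (y \in A).
apply: (@set_extension_ind _ P A); rewrite ?subsetT //.
  by exists f; split=> // b ->.
move=> D b AD _ _ bD [g [injg gf gC]].
have bA : b \notin A by apply: contraNN bD; apply: (subsetP AD).
have [v vC vD] : exists2 v, v \in C b & v \notin [set g z | z in D].
  apply: exists_avoiding; apply: leq_trans (le_n b bA).
  apply: leq_ltn_trans (leq_imset_card _ _) _.
  rewrite -H_card -cardsT; apply: proper_card; rewrite properT.
  by apply: contraNneq bD => ->; rewrite inE.
exists (update g b v); split; first exact: update_inj.
  move=> z zA; rewrite /update; case: eqP => [zb|_]; last exact: gf.
  by rewrite zb (negPf bA) in zA.
by move=> z /setU1P; rewrite /update; case: eqP => [-> //|_ []// zD]; apply: gC.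
Qed.

End Embedding.

Local Open Scope ring_scope.

Theorem theorem1p1 (R : realType) (H G : sgraph) (n Delta N : nat) (eps : R)
  (H_bip : bipartite H)
  (H_card : #|H| = n)
  (H_deg : max_degree H = Delta)
  (Delta_ge1 : (1 <= Delta)%N)
  (eps_gt0 : 0 < eps)
  (G_card : #|G| = N)
  (N_gt1 : (1 < N)%N)
  (N_ge : 32%:R * Delta%:R * eps ^- Delta * n%:R <= N%:R)
  (G_edges : eps * 'C(N, 2)%:R <= #|edges G|%:R) :
  is_subgraph H G.
Proof.
have [A A_bip] := H_bip.
have deg_le (x : H) : (#|nbrs x| <= Delta)%N.
  by rewrite -H_deg; apply: (leq_bigmax (F := @degree H)).
(* An empty [H] would have maximum degree 0. *)
have n0 : (0 < n)%N.
  rewrite lt0n -H_card; apply/eqP => /card0_eq H0.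
  by move: Delta_ge1; rewrite -H_deg /max_degree big_pred0.
rewrite -G_card in N_gt1 N_ge G_edges.
have [U [le_U few]] :=
  dependent_random_choice eps_gt0 Delta_ge1 n0 N_gt1 N_ge G_edges.
have [f [injf le_n]] := greedy_embed_side H_card deg_le A_bip Delta_ge1 n0 le_U few.
exact: (greedy_embed_rest H_card A_bip injf le_n).
Qed.
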